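(* Let $3 \le r \le 7$. Every $K_r$-minor free graph $G$ with at least one edge has an edge $uv$ such that $\deg(u) \le 2r-5$ and $uv$ belongs to at most $r-3$ triangles of $G$.
   Context: All graphs are finite and simple. A minor of $G$ is a graph obtained from $G$ by a sequence of edge deletions, edge contractions and vertex deletions; $G$ is $H$-minor free if it has no minor isomorphic to $H$. An edge $uv$ belongs to a triangle $uvw$ whenever $w$ is a common neighbour of $u$ and $v$. *)

(* Defs.v *)
(* Finite simple graphs = symmetric irreflexive relations on a finType. *)
From mathcomp Require Import all_boot.
Set Implicit Arguments. Unset Strict Implicit. Unset Printing Implicit Defensive.

Definition del_edge (U : finType) (e : rel U) (a b : U) : rel U :=
  fun x y => e x y && ~~ (((x == a) && (y == b)) || ((x == b) && (y == a))).

Definition del_vert (U : finType) (e : rel U) (v : U) : rel {x : U | x != v} :=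
  fun x y => e (val x) (val y).

(* Contraction of the edge ab: b is merged into a; the new vertex set is
   U \ {b}, the merged vertex being a; loops and parallel edges are dropped. *)
Definition contract (U : finType) (e : rel U) (a b : U) : rel {x : U | x != b} :=
  fun x y => (val x != val y) &&
    [|| e (val x) (val y), (val x == a) && e b (val y) | (val y == a) && e b (val x)].

Inductive minor (T : finType) (e : rel T) : forall U : finType, rel U -> Prop :=
| minor_refl : minor e e
| minor_del_edge (U : finType) (eU : rel U) (a b : U) :
    minor e eU -> minor e (del_edge eU a b)
| minor_del_vert (U : finType) (eU : rel U) (v : U) :
    minor e eU -> @minor T e {x : U | x != v} (@del_vert U eU v)
| minor_contract (U : finType) (eU : rel U) (a b : U) :
    eU a b -> minor e eU -> @minor T e {x : U | x != b} (@contract U eU a b).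

Definition complete_rel (r : nat) : rel 'I_r := fun i j => i != j.

Definition graph_iso (U V : finType) (eU : rel U) (eV : rel V) : Prop :=
  exists f : U -> V, bijective f /\ forall x y, eV (f x) (f y) = eU x y.

Definition has_K_minor (T : finType) (e : rel T) (r : nat) : Prop :=
  exists (U : finType) (eU : rel U), minor e eU /\ @graph_iso U (ordinal r) eU (@complete_rel r).

Definition deg (T : finType) (e : rel T) (u : T) : nat := #|[set w | e u w]|.

(* number of triangles containing the edge uv = number of common neighbours *)
Definition ntri (T : finType) (e : rel T) (u v : T) : nat :=
  #|[set w | e u w && e v w]|.

(* Main.v *)
Require Import Defs.
From mathcomp Require Import all_boot.
From mathcomp Require Import zify.
From Stdlib Require Import BinNat.
Set Implicit Arguments. Unset Strict Implicit. Unset Printing Implicit Defensive.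

(** The theorem and Mader's bound (for [3 <= r <= 7], a graph with [n >= r - 2]
    vertices and more than [(r - 2) n - binomial r.-1 2] edges has a [K_r] minor)
    are proved by one induction on [n].

    For Mader's bound: an edge in at most [r - 3] triangles can be contracted, and an
    edge can be deleted while all degrees are at least [2r - 4]; what remains is the
    situation of the theorem, with a vertex of degree at most [2r - 5].

    For the theorem: call a vertex [u] small if [deg u <= 2r - 5], and suppose that every
    edge at a small vertex is in at least [r - 2] triangles. Then [H := G[N(u)]] has at
    most [2r - 5] vertices and minimum degree at least [r - 2], so there are finitely many
    [H] up to isomorphism, and only a few of them have no [K_{r-1}] minor. Take a small [u]
    and a component [C] of [G - N[u]] with [C] as small as possible.
    - If [C] contains a small [w], let [D] be the component of [G - N[w]] containing [u].
      By minimality a neighbour [y] of [w] that has no neighbour in [D] satisfies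
      [N(y) <= N[w]], so [y] is small and its edges lie in many triangles of [N[w]]; since
      few vertices of [H] are like that, contracting [D] gives [K_r].
    - Otherwise all degrees in [C] are at least [2r - 4]. Let [S := N(C)]. Either
      contracting [C] gives [K_r], or contracting the rest of [N[u]] into [S] creates so
      many edges on [S] that Mader's bound applies to the smaller graph on [C] and [S].
    The two statements about [H] are verified by computation. *)

(** * Minors on a fixed vertex type *)

Lemma minor_trans (T U W : finType) (e : rel T) (eU : rel U) (eW : rel W) :
  minor e eU -> minor eU eW -> minor e eW.
Proof.
move=> eU_e; elim=> [|V eV a b _|V eV v _|V eV a b ab _] //.
- exact: minor_del_edge.
- exact: minor_del_vert.
- exact: minor_contract.
Qed.

Lemma has_K_minor_trans (T U : finType) (e : rel T) (eU : rel U) r :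
  minor e eU -> has_K_minor eU r -> has_K_minor e r.
Proof. by move=> eU_e [W [eW [? ?]]]; exists W, eW; split=> //; apply: minor_trans eU_e _. Qed.

Lemma clique_has_K_minor (U : finType) (e : rel U) (B : {set U}) :
  irreflexive e -> {in B &, forall x y, x != y -> e x y} -> has_K_minor e #|B|.
Proof.
have [n] := ubnP #|U|; elim: n U e B => // n IHn U e B leUn irr_e clB.
have [BT|/existsP[v vB]] := altP (@forallPP U _ _ (fun x => @idP (x \in B))).
  have -> : #|B| = #|U| by apply: eq_card => x; rewrite BT.
  exists U, e; split; first exact: minor_refl.
  exists enum_rank; split=> [|x y]; first exact: enum_rank_bij.
  rewrite /complete_rel (inj_eq enum_rank_inj).
  by have [->|xy] := eqVneq x y; rewrite ?irr_e // clB ?BT.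
apply: (has_K_minor_trans (minor_del_vert v (minor_refl e))).
pose B' := [set x : {x : U | x != v} | val x \in B].
have -> : #|B| = #|B'|.
  rewrite -(card_imset _ val_inj); apply: eq_card => x.
  apply/idP/imsetP => [xB|[y]]; last by rewrite inE => yB ->.
  have xv : x != v by apply: contraNneq vB => <-.
  by exists (Sub x xv); rewrite // inE.
apply: IHn.
- rewrite card_sig -ltnS; apply: leq_trans leUn; rewrite ltnS.
  by rewrite [X in _ < X](cardD1 v) inE add1n ltnS subset_leq_card //; apply/subsetP=> x; rewrite !inE andbT.
- by move=> x; exact: irr_e.
- by move=> x y; rewrite !inE -val_eqE; exact: clB.
Qed.

Section FixedVertices.
Variable T : finType.
Implicit Types (e : rel T) (v : nat -> T).

(* Contraction without changing the vertex type: [b] stays as an isolated vertex. *)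
Definition contr e a b : rel T := fun x y =>
  [&& x != b, y != b, x != y & [|| e x y, (x == a) && e b y | (y == a) && e b x]].

(** Contractions come first; all deletions are absorbed into the final choice of a clique. *)
Inductive K_model r : rel T -> Prop :=
| K_model_clique e (B : {set T}) :
    #|B| = r -> {in B &, forall x y, x != y -> e x y} -> K_model r e
| K_model_contr e a b : e a b -> K_model r (contr e a b) -> K_model r e.

Lemma K_model_mono r e e' : subrel e e' -> K_model r e -> K_model r e'.
Proof.
move=> sub K; elim: K e' sub => {e} [e B cB clB|e a b ab _ IH] e' sub.
  by apply: (K_model_clique cB) => x y xB yB xy; apply/sub/clB.
apply: (@K_model_contr _ _ a b); first exact: sub.
apply: IH => x y /and4P[xb yb xy H]; apply/and4P; split=> //.
by case/or3P: H => [/sub->//|/andP[-> /sub->]|/andP[-> /sub->]]; rewrite ?orbT.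
Qed.

Lemma K_model_geq r e (B : {set T}) :
  r <= #|B| -> {in B &, forall x y, x != y -> e x y} -> K_model r e.
Proof.
move=> leB clB; have : 0 < #|[set A : {set T} | A \subset B & #|A| == r]|.
  by rewrite cards_draws bin_gt0.
case/card_gt0P=> A; rewrite inE => /andP[/subsetP sAB /eqP cA].
by apply: (K_model_clique cA) => x y /sAB xB /sAB yB; apply: clB.
Qed.

Lemma contr_sym e a b : symmetric e -> symmetric (contr e a b).
Proof.
move=> se x y; rewrite /contr (eq_sym y x) (se y x).
by case: (x != b); case: (y != b) => //=; congr (_ && (_ || _)); rewrite orbC.
Qed.

Lemma contr_irr e a b : irreflexive (contr e a b).
Proof. by move=> x; rewrite /contr eqxx !andbF. Qed.

(** Genuine minors live on shrinking vertex types: [g] embeds the current one in [T], and vertices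
    outside its image are isolated. As [1 < r], clique vertices have neighbours, so they lie in the
    image. *)
Lemma K_model_minor r e : 1 < r -> K_model r e ->
  forall (U : finType) (eU : rel U) (g : U -> T), injective g -> irreflexive eU ->
  (forall x y, eU x y = e (g x) (g y)) ->
  (forall x y, e x y -> x \in codom g /\ y \in codom g) -> has_K_minor eU r.
Proof.
move=> r_gt1; elim=> {e} [e B cB clB|e a b ab _ IH] U eU g g_inj irrU eUE supp.
  pose B' := [set u | g u \in B].
  have -> : r = #|B'|.
    rewrite -cB -(card_imset _ g_inj); apply: eq_card => x.
    apply/idP/imsetP => [xB|[y]]; last by rewrite inE => yB ->.
    have : 0 < #|B :\ x| by move: r_gt1; rewrite -cB (cardsD1 x B) xB.
    case/card_gt0P=> y; rewrite !inE eq_sym => /andP[xy yB].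
    have [/codomP[u xu] _] := supp _ _ (clB _ _ xB yB xy).
    by exists u; rewrite // inE -xu.
  apply: clique_has_K_minor => // x y; rewrite !inE => xB yB xy.
  by rewrite eUE clB // (inj_eq g_inj).
have [/codomP[a' aE] /codomP[b' bE]] := supp _ _ ab.
have ab' : eU a' b' by rewrite eUE -aE -bE.
apply: (has_K_minor_trans (minor_contract ab' (minor_refl eU))).
apply: (IH _ _ (fun x => g (val x))) => [x y /g_inj/val_inj//|x|x y|x y].
- by rewrite /contract eqxx.
- rewrite /contract /contr aE bE !(inj_eq g_inj) !eUE.
  by rewrite (valP x) (valP y).
- case/and4P=> xb yb _ H.
  have codomS z : z != b -> z \in codom g -> z \in codom (fun x : {x : U | x != b'} => g (val x)).
    move=> zb /codomP[u zu]; have ub : u != b' by apply: contraNneq zb => ub; rewrite zu ub bE.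
    by apply/codomP; exists (Sub u ub).
  by case/or3P: H => [/supp[]|/andP[/eqP xa /supp[_ yg]]|/andP[/eqP ya /supp[_ xg]]];
    split; apply: codomS => //; rewrite ?xa ?ya aE codom_f.
Qed.

Lemma K_model_has_K_minor r e : 1 < r -> irreflexive e -> K_model r e -> has_K_minor e r.
Proof.
move=> r_gt1 irr_e K; apply: (K_model_minor r_gt1 K (g := id)) => // x y _.
by rewrite !codom_f.
Qed.

End FixedVertices.

(** * Computations on adjacency matrices *)

(* Under [vm_compute], [has] and [all] do not stop early, since [||] and [&&]
   evaluate both arguments; these variants do. *)
Fixpoint any A (a : A -> bool) (s : seq A) : bool :=
  if s is x :: s' then if a x then true else any a s' else false.
Fixpoint every A (a : A -> bool) (s : seq A) : bool :=
  if s is x :: s' then if a x then every a s' else false else true.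

Lemma anyE A (a : A -> bool) s : any a s = has a s.
Proof. by elim: s => //= x s ->. Qed.

Lemma everyE A (a : A -> bool) s : every a s = all a s.
Proof. by elim: s => //= x s ->. Qed.

(** Rows may be short: missing entries read as [false]. *)
Definition amx := seq (seq bool).
Definition adj (M : amx) i j := nth false (nth [::] M i) j.
Fixpoint or_row (r s : bitseq) : bitseq :=
  match r, s with
  | b :: r', c :: s' => (if b then true else c) :: or_row r' s'
  | [::], _ => s
  | _, [::] => r
  end.
Definition contr_mx (M : amx) a b : amx :=
  let rb := nth [::] M b in
  [seq (let r := nth [::] M i in
        if i == b then [::] else
        if i == a then set_nth false (set_nth false (or_row r rb) b false) a false else
        if nth false r b then set_nth false (set_nth false r b false) a true else r)
    | i <- iota 0 (size M)].
Definition ext_mx (M : amx) (c : bitseq) : amx :=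
  let n := size M in
  rcons [seq set_nth false (nth [::] M i) n (nth false c i) | i <- iota 0 n] (set_nth false c n false).
Definition relabel (M : amx) (p : seq nat) : amx :=
  [seq (let r := nth [::] M i in [seq nth false r j | j <- p]) | i <- p].

Definition deg_mx (M : amx) i := count id (nth [::] M i).
Fixpoint common (r s : seq bool) := match r, s with
  | b :: r', c :: s' => if b then if c then (common r' s').+1 else common r' s' else common r' s'
  | _, _ => 0 end.
Definition clique_mx M s :=
  every (fun i => every (fun j => if adj M i j then true else i == j) s) s.
Fixpoint insert_key A (k : nat) (x : A) (s : seq (nat * A)) :=
  if s is y :: s' then if k <= y.1 then (k, x) :: s else y :: insert_key k x s' else [:: (k, x)].

(* In a connected graph a vertex of degree less than [t - 1] lies in a branch set
   with another vertex, so only the edges at such a vertex have to be tried.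
   Once an edge has been tried, [fb] forbids it in the remaining branches. *)
Fixpoint hasK fuel t M s (fb : seq (nat * nat)) : bool :=
  if clique_mx M s then t <= size s else
  if fuel is f.+1 then
    if size s <= t then false else
    let v := foldr (fun i k => if deg_mx M i <= deg_mx M k then i else k) (head 0 s) s in
    if deg_mx M v is 0 then hasK f t M [seq x <- s | x != v] fb else
    let ps := if t.-1 <= deg_mx M v
      then flatten [seq [seq (i, j) | j <- s & if j <= i then false else adj M i j] | i <- s]
      else [seq (j, v) | j <- s & adj M j v] in
    let qs := foldr (fun p qs => insert_key (common (nth [::] M p.1) (nth [::] M p.2)) p qs) [::] ps in
    (fix try qs fb := if qs is q :: qs' then
       let: (a, b) := q.2 in
       if any (fun p => if p.1 == a then p.2 == b else if p.1 == b then p.2 == a else false) fb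
       then try qs' fb
       else if hasK f t (contr_mx M a b) [seq x <- s | x != b] fb then true
       else try qs' ((a, b) :: fb)
     else false) qs fb
  else false.
Definition hasKM t M := hasK (size M) t M (iota 0 (size M)) [::].

Fixpoint bitseqs k : seq bitseq :=
  if k is k'.+1 then [seq true :: b | b <- bitseqs k'] ++ [seq false :: b | b <- bitseqs k']
  else [:: [::]].
(** Candidate rows for a new vertex: [sat] marks the old vertices that already miss [d] others and
    so must be adjacent to it. *)
Fixpoint bitseqs_le (sat : bitseq) d : seq bitseq :=
  if sat is s :: sat' then
    [seq true :: b | b <- bitseqs_le sat' d] ++
    (if s then [::] else if d is d'.+1 then [seq false :: b | b <- bitseqs_le sat' d'] else [::])
  else [:: [::]].
Definition nonadj (M : amx) i :=
  count (fun j => if j == i then false else ~~ adj M i j) (iota 1 (size M).-1).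
Definition sats d M := [seq d <= nonadj M i | i <- iota 1 (size M).-1].

(* The hashes only serve to remove isomorphic copies; nothing is claimed about
   how well they separate isomorphism classes. *)
Definition hash_step (M : amx) (h : seq N) : seq N :=
  [seq N.land 65535%num (foldr (fun (x : bool * N) acc => if x.1 then N.add (N.mul x.2 x.2) acc else acc)
    (N.mul 3%num rh.2) (zip rh.1 h)) | rh <- zip M h].
Definition hash (M : amx) : seq N :=
  hash_step M (hash_step M (map (fun r => N.of_nat (count id r)) M)).
Fixpoint insert_hash (x : N * nat) s :=
  if s is y :: s' then if N.leb x.1 y.1 then x :: s else y :: insert_hash x s' else [:: x].
Definition hash_order (M : amx) : seq nat :=
  map snd (foldr insert_hash [::] (behead (zip (hash M) (iota 0 (size M))))).
Fixpoint refine (M : amx) (h : seq N) (s : seq nat) k : seq nat :=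
  if k is k'.+1 then
    let v := foldr (fun i j => if N.leb (nth 0%num h i) (nth 0%num h j) then i else j) (head 0 s) s in
    v :: refine M (hash_step M (set_nth 0%num h v (N.add 7%num (nth 0%num h v)))) [seq x <- s | x != v] k'
  else [::].
Definition refined_order (M : amx) : seq nat :=
  refine M (hash M) (iota 1 (size M).-1) (size M).-1.
Definition canon (order : amx -> seq nat) M :=
  let p := 0 :: order M in
  if perm_eq p (iota 0 (size M)) then relabel M p else M.

Fixpoint eq_row (r s : bitseq) : bool :=
  match r, s with
  | [::], [::] => true
  | b :: r', c :: s' => if b then (if c then eq_row r' s' else false) else (if c then false else eq_row r' s')
  | _, _ => false
  end.
Fixpoint eq_amx (M M' : amx) : bool :=
  match M, M' with
  | [::], [::] => true
  | r :: M, s :: M' => if eq_row r s then eq_amx M M' else false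
  | _, _ => false
  end.
Definition code (M : amx) : N :=
  foldr (fun r x => foldr (fun b y => if b then N.succ_double y else N.double y) x r) 0%num M.
Fixpoint dedup_adjacent M (s : seq amx) : seq amx :=
  if s is M' :: s' then
    if eq_amx M M' then dedup_adjacent M s' else M :: dedup_adjacent M' s'
  else [:: M].
Definition dedup (s : seq amx) : seq amx :=
  if sort (fun M M' => N.leb (code M) (code M')) s is M :: s' then dedup_adjacent M s' else [::].

Definition extend r d (L : seq amx) : seq amx :=
  let L1 := flatten [seq [seq canon hash_order (ext_mx M (true :: b)) | b <- bitseqs_le (sats d M) d] | M <- L] in
  dedup [seq canon refined_order M | M <- [seq M <- dedup L1 | ~~ hasKM r M]].
(* The graphs induced by [N[u]]: vertex 0 is [u], and each of the other vertices
   misses at most [d] others; graphs in which a [K_r] minor is found are dropped. *)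
Fixpoint cones r d k : seq amx :=
  if k is k'.+1 then extend r d (cones r d k') else [:: [:: [:: false]]].

(** The bound is [r - 3] rather than [r - 2] since the apex 0, left out of the count, is one more
    common neighbour. *)
Definition good_mx r (M : amx) i :=
  every (fun z => if adj M i z
      then r - 3 <= count (fun j => if adj M i j then adj M z j else false) (iota 1 (size M).-1)
      else true)
    (iota 1 (size M).-1).
(* The new vertex stands for the contracted set [D]. *)
Definition check_nested r (M : amx) :=
  let c := [seq (0 < i) && ~~ good_mx r M i | i <- iota 0 (size M)] in
  if any id c then hasKM r (ext_mx M c) else false.

(* Contracts vertices of [s] until [S] spans [need] edges, counted twice. *)
Fixpoint dense fuel need S (M : amx) s : bool :=
  if need <= sumn [seq count (adj M i) S | i <- S] then true else
  if fuel is f.+1 then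
    any (fun b => any (fun a => if adj M a b
        then dense f need S (contr_mx M a b) [seq x <- s | x != b] else false) (s ++ S)) s
  else false.
(* The demand on [S := N(C)]: if all degrees in [C] are at least [2r - 4] and each vertex
   of [S] has a neighbour in [C], it makes the graph on [C] and [S] exceed Mader's bound. *)
Definition check_attached r (M : amx) (b : bitseq) :=
  let c := false :: b in
  let S := [seq i <- iota 0 (size M) | nth false c i] in
  let s := size S in
  if dense (size M) (2 * (r - 2) * s + 2 - s - r.-1 * (r - 2)) S M
       [seq i <- iota 0 (size M) | ~~ nth false c i] then true
  else hasKM r (ext_mx M c).

Definition check_cone r M :=
  if check_nested r M then every (check_attached r M) (bitseqs (size M).-1) else false.
(** [m] is the degree of [u] and runs from [r - 1] to [2r - 5]; a vertex of [N(u)] with at least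
    [r - 2] neighbours there misses at most [m - (r - 1)] others. *)
Definition check r :=
  every (fun m => every (check_cone r) (cones r (m - r.-1) m)) (iota r.-1 (r - 3)).

(** * Correctness of the matrix operations *)

Lemma size_contr_mx M a b : size (contr_mx M a b) = size M.
Proof. by rewrite size_map size_iota. Qed.

Lemma nth_or_row r s j : nth false (or_row r s) j = nth false r j || nth false s j.
Proof. by elim: r s j => [|x r IH] [|y s] [|j] //=; rewrite orbF. Qed.

Lemma adj_contr_mx M a b i j : a != b -> i < size M ->
  adj (contr_mx M a b) i j = [&& i != b, j != b &
    if i == a then (j != a) && (adj M a j || adj M b j)
    else (adj M i b && (j == a)) || adj M i j].
Proof.
move=> ab li; rewrite /adj (nth_map 0) ?size_iota // nth_iota //= add0n.
have [_|ib] := eqVneq i b; first by rewrite nth_nil.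
have [->|ia] := eqVneq i a.
  by rewrite nth_set_nth /= nth_set_nth /= nth_or_row; case: (j == a); case: (j == b).
case: ifP => [ibM|ibM]; last by case: eqVneq => [->|].
rewrite nth_set_nth /= nth_set_nth /=; have [->|_] := eqVneq j a; first by rewrite ab.
by case: eqP.
Qed.

Lemma size_ext_mx M c : size (ext_mx M c) = (size M).+1.
Proof. by rewrite size_rcons size_map size_iota. Qed.

Lemma adj_ext_mx M c i j : i < (size M).+1 ->
  adj (ext_mx M c) i j = if i == size M then (j != size M) && nth false c j
                         else if j == size M then nth false c i else adj M i j.
Proof.
rewrite ltnS leq_eqVlt => li.
rewrite /adj nth_rcons size_map size_iota.
case: eqVneq li => [->|_ /= li]; first by rewrite ltnn nth_set_nth /=; case: eqP.
by rewrite li (nth_map 0) ?size_iota // nth_iota // nth_set_nth.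
Qed.

Lemma mem_bitseqs (b : bitseq) : b \in bitseqs (size b).
Proof.
elim: b => // x b IH /=; rewrite mem_cat.
by case: x; rewrite (map_f (cons _) IH) ?orbT.
Qed.

Lemma mem_bitseqs_le (sat b : bitseq) d : size b = size sat ->
  (forall i, nth false sat i -> nth false b i) -> count negb b <= d -> b \in bitseqs_le sat d.
Proof.
elim: b sat d => [|x b IH] [|s sat] d //= [sz] sat_b le_d.
rewrite mem_cat; have sat_b' i : nth false sat i -> nth false b i by apply: (sat_b i.+1).
case: x sat_b le_d => /= sat_b le_d; first by rewrite map_f ?IH.
case: s sat_b => [/(_ 0 isT)//|_]; case: d le_d => // d; rewrite add1n ltnS => le_d.
by rewrite (map_f (cons false)) ?IH ?orbT.
Qed.

Lemma eq_amxP M M' : eq_amx M M' -> M = M'.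
Proof.
have rowP r s : eq_row r s -> r = s.
  by elim: r s => [|[] r IH] [|[] s] //= /IH->.
by elim: M M' => [|r M IH] [|s M'] //=; case: ifP => // /rowP-> /IH->.
Qed.

Lemma mem_dedup (M : amx) (s : seq amx) : M \in s -> M \in dedup s.
Proof.
rewrite -(mem_sort (fun M M' => N.leb (code M) (code M'))) /dedup.
case: (sort _ _) => // M' s'; elim: s' M' => //= M2 s' IH M'.
case: ifP => [/eq_amxP->|_]; rewrite inE => /predU1P[MM'|/IH] //.
- by apply: IH; rewrite MM' mem_head.
- by rewrite MM' mem_head.
- by rewrite inE => ->; rewrite orbT.
Qed.

Lemma mem_sort_insert (A : eqType) (key : A -> nat) (s : seq A) q :
  q \in foldr (fun p qs => insert_key (key p) p qs) [::] s -> q.2 \in s.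
Proof.
have ins k x (t : seq (nat * A)) : insert_key k x t =i (k, x) :: t.
  elim: t => //= y t IH z; case: ifP => // _.
  by rewrite !inE IH !inE orbCA.
elim: s q => //= x s IH q; rewrite ins !inE => /predU1P[->|/IH->]; first by rewrite eqxx.
by rewrite orbT.
Qed.

(** * Soundness of the minor search and of relabelling *)

Section Realization.
Variable T : finType.
Implicit Types (e : rel T) (v : nat -> T) (M : amx).

Definition inj_below v n := forall i j, i < n -> j < n -> v i = v j -> i = j.
(** Transferring a minor only takes edges of [M] to edges of [e]; [exact] serves where non-adjacency
    is read off as well. *)
Definition lower M v e := forall i j, i < size M -> j < size M -> adj M i j -> e (v i) (v j).
Definition exact M v e := forall i j, i < size M -> j < size M -> adj M i j = e (v i) (v j).

Lemma exact_lower M v e : exact M v e -> lower M v e.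
Proof. by move=> ex i j li lj; rewrite ex. Qed.

Lemma lower_contr M v e a b : symmetric e -> irreflexive e ->
  inj_below v (size M) -> lower M v e -> a < size M -> b < size M -> adj M a b ->
  lower (contr_mx M a b) v (contr e (v a) (v b)).
Proof.
move=> se irr_e v_inj lowM la lb adj_ab i j; rewrite size_contr_mx => li lj.
have vE k l : k < size M -> l < size M -> (v k == v l) = (k == l).
  by move=> lk ll; apply/eqP/eqP => [/v_inj->|->].
have neq k l : k < size M -> l < size M -> adj M k l -> k != l.
  by move=> lk ll /lowM kl; rewrite -vE //; apply: contraTneq (kl lk ll) => ->; rewrite irr_e.
rewrite adj_contr_mx ?(neq a b) // => /and3P[ib jb H]; rewrite /contr !vE // ib jb /=.
case: eqVneq H => [->|ia H].
  case/andP=> ja /orP[aj|bj]; rewrite eq_sym ja /=; first by rewrite lowM.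
  by rewrite (lowM b j) // orbT.
case/orP: H => [/andP[ib' /eqP->]|ij].
  by rewrite ia eqxx /= [e (v b) _]se (lowM i b) ?orbT.
by rewrite (neq i j) // lowM.
Qed.

Lemma clique_mx_sound t M v e s : inj_below v (size M) -> uniq s ->
  {in s, forall i, i < size M} -> lower M v e -> clique_mx M s -> t <= size s -> K_model t e.
Proof.
move=> v_inj us s_lt lowM; rewrite /clique_mx everyE => cl le_t.
apply: (@K_model_geq _ _ _ [set x in map v s]) => [|x y].
  have /card_uniqP us' : uniq (map v s).
    by rewrite map_inj_in_uniq // => i j /s_lt li /s_lt lj; apply: v_inj.
  by rewrite cardsE us' size_map.
rewrite !inE => /mapP[i si ->] /mapP[j sj ->] ij.
have := allP cl i si; rewrite everyE => /allP/(_ j sj).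
case: ifP => [/lowM-> //|_ /eqP eij]; rewrite ?s_lt //; by rewrite eij eqxx in ij.
Qed.

(** Every branch contracts an edge of [M] inside [s] or drops a vertex from [s], and the pruning
    rules can only lose minors; hence success is sound for any [fb]. *)
Lemma hasK_sound f t M v e s fb : symmetric e -> irreflexive e -> inj_below v (size M) ->
  uniq s -> {in s, forall i, i < size M} -> lower M v e -> hasK f t M s fb -> K_model t e.
Proof.
elim: f M e s fb => [|f IH] M e s fb se irr_e v_inj us s_lt lowM /=.
  by case: ifP => // cl le_t; exact: (clique_mx_sound v_inj us s_lt lowM cl le_t).
case: ifP => [cl le_t|_]; first exact: (clique_mx_sound v_inj us s_lt lowM cl le_t).
case: ifP => // /negbT; rewrite -ltnNge => lt_t; set v0 := foldr _ _ _.
have v0s : v0 \in s.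
  case: s lt_t @v0 {us s_lt} => //= i s _; case: ifP => _; rewrite ?mem_head //.
  elim: s => [|j s IHs] /=; first by rewrite mem_head.
  by case: ifP; rewrite !inE ?eqxx ?orbT //; move: IHs; rewrite !inE => /orP[]->; rewrite ?orbT.
have us' k : uniq [seq x <- s | x != k] by rewrite filter_uniq.
have s_lt' k : {in [seq x <- s | x != k], forall i, i < size M}.
  by move=> i; rewrite mem_filter => /andP[_ /s_lt].
case E: (deg_mx M v0) => [|d]; first exact: IH.
set qs := foldr _ _ _.
have qsP : {in qs, forall q, [/\ q.2.1 \in s, q.2.2 \in s & adj M q.2.1 q.2.2]}.
  move=> [n [a b]] /mem_sort_insert /=; case: ifP => _.
    case/flattenP=> l /mapP[i si ->] /mapP[j]; rewrite mem_filter => /andP[].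
    by case: ifP => // _ ij sj [-> ->].
  by case/mapP=> j; rewrite mem_filter => /andP[vj sj] [-> ->].
elim: qs qsP fb => // -[n [a b]] qs IHqs qsP fb /=.
have qsP' : {in qs, forall q, [/\ q.2.1 \in s, q.2.2 \in s & adj M q.2.1 q.2.2]}.
  by move=> q qqs; apply: qsP; rewrite inE qqs orbT.
have [/= sa sb ab] := qsP _ (mem_head _ _).
case: ifP => _; first exact: (IHqs qsP').
case: ifP => [Kab _|_]; last exact: (IHqs qsP').
apply: (@K_model_contr _ _ _ (v a) (v b)); first by apply: lowM; rewrite ?s_lt.
apply: IH Kab; rewrite ?size_contr_mx //.
- exact: contr_sym.
- exact: contr_irr.
- by apply: lower_contr; rewrite ?s_lt.
Qed.

Lemma hasKM_sound t M v e : symmetric e -> irreflexive e -> inj_below v (size M) ->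
  lower M v e -> hasKM t M -> K_model t e.
Proof.
move=> se irr_e v_inj lowM.
by apply: (hasK_sound se irr_e v_inj (iota_uniq _ _) _ lowM) => i; rewrite mem_iota.
Qed.

Lemma lower_ext M v e c d : lower M v e -> symmetric e ->
  (forall i, i < size M -> nth false c i -> e d (v i)) ->
  lower (ext_mx M c) (fun i => if i == size M then d else v i) e.
Proof.
move=> lowM se c_d i j; rewrite size_ext_mx => li lj; rewrite adj_ext_mx //.
case: eqVneq => [_|ni]; case: eqVneq => [_|nj] //.
- by apply: c_d; lia.
- by rewrite se; apply: c_d; lia.
- by apply: lowM; lia.
Qed.

Lemma inj_below_ext v n d : inj_below v n -> (forall i, i < n -> v i != d) ->
  inj_below (fun i => if i == n then d else v i) n.+1.
Proof.
move=> v_inj vd i j li lj.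
case: eqVneq => [->|ni]; case: eqVneq => [-> //|nj].
- by move/esym/eqP; rewrite (negbTE (vd _ _)) //; lia.
- by move/eqP; rewrite (negbTE (vd _ _)) //; lia.
- by apply: v_inj; lia.
Qed.

Lemma exact_ext M v e c d : exact M v e -> symmetric e -> irreflexive e ->
  (forall i, i < size M -> nth false c i = e d (v i)) ->
  exact (ext_mx M c) (fun i => if i == size M then d else v i) e.
Proof.
move=> exM se irr_e c_d i j; rewrite size_ext_mx => li lj; rewrite adj_ext_mx //.
case: eqVneq => [_|ni]; case: eqVneq => [_|nj] //.
- by apply: c_d; lia.
- by rewrite se; apply: c_d; lia.
- by apply: exM; lia.
Qed.

Lemma canon_sound order M v e : inj_below v (size M) -> exact M v e -> 0 < size M ->
  exists p : nat -> nat, [/\ size (canon order M) = size M, p 0 = 0, forall i, i < size M -> p i < size M,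
    inj_below (v \o p) (size M) & exact (canon order M) (v \o p) e].
Proof.
move=> v_inj exM M_gt0; rewrite /canon; case: ifP => [pP|_]; last by exists id.
exists (nth 0 (0 :: order M)); have szp := perm_size pP; rewrite size_iota in szp.
have p_lt i : i < size M -> nth 0 (0 :: order M) i < size M.
  by move=> li; have := mem_nth 0 (_ : i < size (0 :: order M)); rewrite szp (perm_mem pP) mem_iota; apply.
split=> //; first by rewrite size_map szp.
- move=> i j li lj /= /v_inj; rewrite !p_lt // => /(_ isT isT)/eqP.
  by rewrite nth_uniq ?szp ?(perm_uniq pP) ?iota_uniq // => /eqP.
- move=> i j; rewrite size_map szp => li lj.
  by rewrite /adj (nth_map 0) ?szp // (nth_map 0) ?szp // -/(adj _ _ _) exM ?p_lt.
Qed.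

End Realization.

(** * Neighbourhoods of vertices of small degree *)

Section Cones.
Variables (T : finType) (e : rel T).
Hypotheses (se : symmetric e) (irr_e : irreflexive e).

Definition nbr (f : rel T) x := [set y | f x y].
Local Notation N := (nbr e).

Definition cone u k (M : amx) (v : nat -> T) :=
  [/\ size M = k.+1, inj_below v k.+1, v 0 = u,
      forall i, 0 < i <= k -> v i \in N u & exact M v e].

Lemma uniq_size_leq_card (A : {set T}) (s : seq T) : uniq s -> {subset s <= A} -> size s <= #|A|.
Proof. by move=> us sA; rewrite -(card_uniqP us); apply/subset_leq_card/subsetP. Qed.

Lemma cone_map_uniq u k M v (s : seq nat) : cone u k M v -> uniq s -> {in s, forall i, i <= k} ->
  uniq (map v s).
Proof.
case=> _ v_inj _ _ _ us s_le; rewrite map_inj_in_uniq // => i j /s_le li /s_le lj.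
by apply: v_inj.
Qed.

Lemma cone_surj u M v : cone u #|N u| M v -> forall y, y \in N u -> exists2 i, 0 < i <= #|N u| & v i = y.
Proof.
move=> coneM y yN; case: (coneM) => szM v_inj v0 vN _.
pose s := map v (iota 1 #|N u|).
have us : uniq s.
  by apply: cone_map_uniq coneM (iota_uniq _ _) _ => i; rewrite mem_iota; lia.
have sN : {subset s <= N u} by move=> x /mapP[i]; rewrite mem_iota => li ->; apply: vN; lia.
have [|_ sE] := uniq_min_size us (fun x xs => etrans (mem_enum _ _) (sN x xs)).
  by rewrite -cardE size_map size_iota.
have : y \in s by rewrite sE mem_enum.
by case/mapP=> i; rewrite mem_iota => li ->; exists i; first by lia.
Qed.

Lemma cone_canon order u k M v : cone u k M v -> exists v', cone u k (canon order M) v'.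
Proof.
case=> szM v_inj v0 vN exM; rewrite -szM in v_inj.
have [|p [szC p0 p_lt vp_inj exC]] := canon_sound order v_inj exM; first by rewrite szM.
rewrite szM in szC p_lt vp_inj.
exists (v \o p); split=> //; first by rewrite /= p0.
move=> i /andP[i_gt0 li]; apply: vN; rewrite lt0n -ltnS p_lt // andbT.
by apply: contraTneq i_gt0 => pi0; rewrite (vp_inj i 0) //= pi0 p0.
Qed.

(** Neighbours of [u] are added one at a time. Apart from duplicates, a graph leaves the list only
    when a [K_r] minor was found in it, which is the first alternative. *)
Lemma cones_complete r d u :
  (forall y, y \in N u -> #|[set x in N u | (x != y) && ~~ e y x]| <= d) ->
  forall k, k <= #|N u| -> K_model r e \/
    exists (M : amx) v, M \in cones r d k /\ cone u k M v.
Proof.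
move=> le_d; elim=> [_|k IH lt_k].
  right; exists [:: [:: false]], (fun=> u); split; first by rewrite inE.
  split=> // [i j li lj _|i li|[|i] [|j] // _ _]; first (by lia); first by lia.
case: (IH (ltnW lt_k)) => [|[M [v [Mc coneM]]]]; [by left|].
case: (coneM) => szM v_inj v0 vN exM.
have [x xN xv] : exists2 x, x \in N u & forall i, i <= k -> v i != x.
  have /subsetPn[x xN xv] : ~~ (N u \subset [set x in map v (iota 1 k)]).
    apply/negP => /subset_leq_card; rewrite leqNgt => /negP; apply.
    apply: leq_ltn_trans lt_k; rewrite cardsE (leq_trans (card_size _)) //.
    by rewrite size_map size_iota.
  exists x => // -[|i] li; first by rewrite v0; apply: contraTneq xN => <-; rewrite inE irr_e.
  apply: contraNneq xv => <-; rewrite inE map_f // mem_iota; lia.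
(* Vertex 0 is skipped, so entry [i] of [b] concerns [v i.+1]; the leading [true] in [M1] is the
   edge from [x] to [u]. *)
pose b := [seq e x (v i) | i <- iota 1 k].
have nth_b i : i < k -> nth false b i = e x (v i.+1).
  by move=> li; rewrite (nth_map 0) ?size_iota // nth_iota.
pose M1 := ext_mx M (true :: b); pose v1 i := if i == size M then x else v i.
have szM1 : size M1 = k.+2 by rewrite size_ext_mx szM.
have v1_inj : inj_below v1 (size M1).
  by rewrite szM1 -szM; apply: inj_below_ext; rewrite szM // => i li; apply: xv.
have exM1 : exact M1 v1 e.
  apply: exact_ext => // -[|i]; rewrite szM /= => li; last by rewrite nth_b.
  by rewrite v0 se; move: xN; rewrite inE => ->.
have v10 : v1 0 = u by rewrite /v1 szM.
have v1N i : 0 < i <= k.+1 -> v1 i \in N u.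
  by move=> li; rewrite /v1 szM; case: eqVneq => // ni; apply: vN; lia.
have coneM1 : cone u k.+1 M1 v1 by split=> //; rewrite -szM1.
have [v2 coneM2] := cone_canon hash_order coneM1; have [szM2 v2_inj _ _ exM2] := coneM2.
case KM: (hasKM r (canon hash_order M1)).
  by left; apply: hasKM_sound (exact_lower exM2) KM; rewrite ?szM2.
have [v3 coneM3] := cone_canon refined_order coneM2.
right; exists (canon refined_order (canon hash_order M1)), v3; split=> //=.
apply/mem_dedup/map_f; rewrite mem_filter KM /=; apply/mem_dedup/flattenP.
exists [seq canon hash_order (ext_mx M (true :: b)) | b <- bitseqs_le (sats d M) d]; first exact: map_f.
apply/mapP; exists b => //.
have us1 (a : pred nat) : uniq (map v (filter a (iota 1 k))).
  apply: cone_map_uniq coneM _ _; first by rewrite filter_uniq ?iota_uniq.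
  by move=> i; rewrite mem_filter mem_iota; lia.
apply: mem_bitseqs_le; first by rewrite !size_map !size_iota szM.
- move=> i; have [li|li] := ltnP i k; last by rewrite nth_default ?size_map ?size_iota ?szM.
  rewrite nth_b // (nth_map 0) ?size_iota ?szM // nth_iota //= add1n => d_le.
  (* A saturated vertex that missed [x] would miss it besides [d] earlier ones, against [le_d]. *)
  apply: contraLR (le_d (v i.+1) (vN _ _)) => [nx|]; last by lia.
  rewrite -ltnNge; apply: leq_ltn_trans d_le _.
  rewrite /nonadj szM /= -size_filter -(size_map v).
  set s := filter _ _; apply: (@uniq_size_leq_card _ (x :: map v s)).
    rewrite /= us1 andbT; apply/mapP => -[j]; rewrite mem_filter mem_iota => /andP[_ lj] xj.
    by have := xv j; rewrite xj eqxx; lia.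
  move=> y; rewrite !inE => /predU1P[->|/mapP[j]].
    move: xN; rewrite inE => -> /=; rewrite [_ == v _]eq_sym (xv _ li) /= se; exact: nx.
  rewrite mem_filter mem_iota => /andP[]; case: eqVneq => // ji nadj lj ->.
  have [lj1 lj2] : 0 < j <= k /\ j < k.+1 by move: lj; clear; lia.
  move: nadj; rewrite exM ?szM // => nadj.
  have := vN j lj1; rewrite inE => ->; rewrite nadj andbT /=.
  by apply: contraNneq ji => /v_inj->.
- rewrite count_map -size_filter -(size_map v).
  apply: leq_trans (le_d x xN); apply: uniq_size_leq_card => // y /mapP[i].
  rewrite mem_filter mem_iota => /andP[/= nadj li] ->.
  have [li1 li2] : 0 < i <= k /\ i <= k by move: li; clear; lia.
  by have := vN i li1; rewrite !inE => ->; rewrite nadj xv.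
Qed.

End Cones.

(** * Connected sets, components and their contraction *)

Section Linked.
Variable T : finType.
Implicit Types (e : rel T) (D X K : {set T}).

(** Connectedness of [D] with root [d], in a cut form that passes to [D :\ b] when [b] is merged
    into [d]. *)
Definition linked e d D :=
  d \in D /\ forall X, d \in X -> X \proper D -> exists x y, [/\ x \in X, y \in D, y \notin X & e x y].

(** The cut at [[set d]] gives an edge from [d] to some [b] in [D]; contract it and recurse on
    [D :\ b]. In the end [d] has inherited all edges from [D] to the outside. *)
Lemma contract_linked r e d D : symmetric e -> irreflexive e -> linked e d D ->
  exists e', [/\ symmetric e' /\ irreflexive e', K_model r e' -> K_model r e,
    forall x y, x \notin D -> y \notin D -> e x y -> e' x y &
    forall y z, y \notin D -> z \in D -> e z y -> e' d y].
Proof.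
have [n] := ubnP #|D|; elim: n D e => // n IH D e leDn se irr_e [dD cut].
have neqe x y : e x y -> x != y by apply: contraTneq => ->; rewrite irr_e.
have [D1|Dd] := boolP (D \subset [set d]).
  exists e; split=> // y z _ /(subsetP D1); rewrite inE => /eqP->//.
have [|x [b [/set1P-> bD]]] := cut [set d] (set11 d).
  by rewrite properE Dd andbT sub1set.
rewrite inE => bd db; pose e1 := contr e d b.
have e1I x1 y1 : x1 != b -> y1 != b -> e x1 y1 -> e1 x1 y1.
  by move=> xb yb xy; rewrite /e1 /contr xb yb xy (neqe _ _ xy).
have e1d y1 : y1 != b -> y1 != d -> e b y1 -> e1 d y1.
  by move=> yb yd by1; rewrite /e1 /contr eq_sym bd yb eq_sym yd eqxx by1 /= orbT.
have [||||e' [[se' irr'] Ke' e'I e'd]] := IH (D :\ b) e1.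
- by move: leDn; rewrite (cardsD1 b D) bD.
- exact: contr_sym.
- exact: contr_irr.
- split=> [|X dX /properP[/subsetP XD [z zD zX]]]; first by rewrite !inE eq_sym bd.
  have bX : b \notin X by apply/negP => /XD; rewrite !inE eqxx.
  (* The original cut is taken at [b |: X]; an edge leaving it from [b] becomes an edge from [d]. *)
  have [||x1 [y1 [x1X y1D y1X xy]]] := cut (b |: X); first by rewrite !inE dX orbT.
    apply/properP; split; last first.
      by move: zD; rewrite !inE => /andP[zb zD]; exists z; rewrite // !inE (negbTE zb).
    by rewrite subUset sub1set bD; apply/subsetP => y /XD; rewrite inE => /andP[].
  move: y1X; rewrite !inE negb_or => /andP[y1b y1X].
  have yd : y1 != d by apply: contraNneq y1X => ->.
  move: x1X; rewrite !inE => /predU1P[xb|x1X].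
    by exists d, y1; split; rewrite ?inE ?y1b //; apply: e1d => //; rewrite -xb.
  exists x1, y1; split; rewrite ?inE ?y1b //; apply: e1I => //.
  by apply: contraNneq bX => <-.
have outb y : y \notin D -> [/\ y != b, y != d & y \notin D :\ b].
  move=> yD; split; last by rewrite inE (negbTE yD) andbF.
  - by apply: contraNneq yD => ->.
  - by apply: contraNneq yD => ->.
exists e'; split=> // [/Ke'|x1 y1 /outb[? ? ?] /outb[? ? ?] xy|y1 z /outb[y1b y1d ?] zD zy].
- exact: K_model_contr.
- by apply: e'I => //; apply: e1I.
- have [zb|zb] := eqVneq z b; last by apply: (e'd _ z) => //; [rewrite !inE zb | apply: e1I].
  by apply: (e'd _ d) => //; [rewrite !inE eq_sym bd | apply: e1d => //; rewrite -zb].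
Qed.

Definition outside e K : rel T := fun x y => [&& e x y, x \notin K & y \notin K].
Definition component e K c := [set y | connect (outside e K) c y].

Variables (e : rel T) (K : {set T}).
Hypothesis se : symmetric e.

Lemma outside_sym : symmetric (outside e K).
Proof. by move=> x y; rewrite /outside se (andbC (x \notin K)). Qed.

Lemma component_self c : c \in component e K c. Proof. by rewrite inE connect0. Qed.

Lemma component_out c y : c \notin K -> y \in component e K c -> y \notin K.
Proof.
move=> cK; rewrite inE => /connectP[p]; elim: p c cK => [|z p IH] c cK /= ; first by move=> _ ->.
by case/andP=> /and3P[_ _ zK]; apply: IH.
Qed.

Lemma component_step c x y : c \notin K -> x \in component e K c -> e x y -> y \notin K -> y \in component e K c.
Proof.
move=> cK xC xy yK; have xK := component_out cK xC; move: xC; rewrite !inE => cx.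
by apply: connect_trans cx (connect1 _); rewrite /outside xy xK.
Qed.

Lemma component_eq c x : x \in component e K c -> component e K x = component e K c.
Proof.
rewrite inE => cx; apply/setP => y; rewrite !inE.
by rewrite (same_connect (sym_connect_sym outside_sym) cx).
Qed.

Lemma component_linked c : linked e c (component e K c).
Proof.
split=> [|X cX /properP[/subsetP XC [y]]]; first exact: component_self.
rewrite inE => /connectP[p]; elim: p c cX XC => [|z p IH] c cX XC /=.
  by move=> _ -> /negP[].
case/andP=> cz pz yE yX; have [zX|zX] := boolP (z \in X).
  have zc : component e K z = component e K c by apply: component_eq; rewrite inE connect1.
  by rewrite -zc; apply: IH; rewrite ?zc.
exists c, z; split; rewrite ?inE ?connect1 //; by case/and3P: cz.
Qed.

End Linked.

(** * From the verified checks to minors *)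

Section Checks.
Variables (T : finType) (e : rel T) (r : nat).
Hypotheses (se : symmetric e) (irr_e : irreflexive e).
Local Notation N := (nbr e).

Definition good w y := [forall z in N w, e y z ==> (r - 3 <= #|N w :&: N y :&: N z|)].

Lemma good_mx_complete w M v i : cone e w #|N w| M v -> 0 < i <= #|N w| -> good w (v i) -> good_mx r M i.
Proof.
move=> coneM li gd; case: (coneM) => szM v_inj v0 vN exM.
rewrite /good_mx everyE szM /=; apply/allP => z; rewrite mem_iota => lz.
rewrite exM ?szM; try lia; case: ifP => // iz.
have := forallP gd (v z); rewrite vN ?iz /=; last lia.
move/leq_trans; apply; rewrite -size_filter -(size_map v).
apply: leq_trans (card_size _); apply/subset_leq_card/subsetP => y.
rewrite !inE => /andP[/andP[wy iy] zy].
have [|j lj yE] := cone_surj coneM (y := y); first by rewrite inE.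
rewrite -yE map_f // mem_filter mem_iota !exM ?szM ?yE ?iy ?zy //=; lia.
Qed.

Lemma check_nested_bad w M v : cone e w #|N w| M v -> check_nested r M ->
  exists2 y, y \in N w & ~~ good w y.
Proof.
move=> coneM; rewrite /check_nested anyE; case: ifP => // /hasP[b /mapP[i]].
case: (coneM) => szM _ _ vN _; rewrite mem_iota szM => li -> /andP[i_gt0 bad] _.
exists (v i); first by apply: vN; lia.
by apply: contra bad => gd; apply: good_mx_complete coneM _ gd; lia.
Qed.

(** Contracting [D] to [d] makes [d] adjacent to every neighbour of [w] that is not good, so [d] can
    stand for the vertex added in [check_nested]. *)
Lemma check_nested_sound w M v d (D : {set T}) : cone e w #|N w| M v -> check_nested r M ->
  linked e d D -> w \notin D -> [disjoint N w & D] ->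
  (forall y, y \in N w -> good w y \/ exists2 z, z \in D & e z y) -> K_model r e.
Proof.
move=> coneM; rewrite /check_nested anyE; case: ifP => // _ KM lD wD ND attached.
case: (coneM) => szM v_inj v0 vN exM; have [dD _] := lD.
have vD i : i < #|N w|.+1 -> v i \notin D.
  case: i => [|i] li; rewrite ?v0 //; apply/negP; rewrite (disjointFr ND) //; exact: vN.
have [e' [[se' irr'] Ke' e'I e'd]] := contract_linked r se irr_e lD.
apply/Ke'/(hasKM_sound (v := fun i => if i == size M then d else v i) se' irr' _ _ KM).
- by rewrite size_ext_mx szM; apply: inj_below_ext => // i /vD; apply: contraNneq => ->.
- apply: lower_ext => // [i j li lj|i li].
    by rewrite exM // => vij; apply: e'I => //; apply: vD; rewrite -szM.
  rewrite (nth_map 0) ?size_iota // nth_iota // add0n => /andP[i_gt0 bad].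
  have viN : v i \in N w by apply: vN; lia.
  case: (attached _ viN) => [gd|[z zD zv]].
    by rewrite (good_mx_complete coneM _ gd) ?i_gt0 // in bad; lia.
  by apply: e'd zv => //; apply: vD; rewrite -szM.
Qed.

(** Only vertices of [s] are merged away, and they have no neighbours in [C]; hence adjacencies at
    [C] do not change. *)
Lemma dense_sound f need S M s e1 v (C : {set T}) :
  inj_below v (size M) -> symmetric e1 -> irreflexive e1 -> lower M v e1 ->
  {in s, forall i, i < size M} -> {in S, forall i, i < size M} ->
  {in C, forall x i, i < size M -> v i != x} ->
  {in C, forall x, {in s, forall i, ~~ e1 x (v i)}} -> dense f need S M s ->
  exists e' (M' : amx), [/\ K_model r e' -> K_model r e1, symmetric e' /\ irreflexive e',
    {in C, forall x y, e' x y = e1 x y}, size M' = size M /\ lower M' v e' &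
    need <= sumn [seq count (adj M' i) S | i <- S]].
Proof.
elim: f M s e1 => [|f IH] M s e1 v_inj se1 irr1 lowM s_lt S_lt vC Cs /=.
  by case: ifP => // le_need _; exists e1, M; split.
case: ifP => [le_need _|_]; first by exists e1, M; split.
rewrite anyE => /hasP[b bs]; rewrite anyE => /hasP[a]; rewrite mem_cat => aS.
have la : a < size M by case/orP: aS; [apply: s_lt | apply: S_lt].
have lb := s_lt _ bs; case: ifP => // ab Hd; have eab := lowM _ _ la lb ab.
pose e2 := contr e1 (v a) (v b).
have e2C : {in C, forall x y, e2 x y = e1 x y}.
  move=> x xC y; rewrite /e2 /contr (eq_sym x) vC // (eq_sym x (v a)) (negbTE (vC x xC a la)) /=.
  have /negbTE nxb := Cs x xC b bs; rewrite (se1 (v b) x) nxb andbF orbF.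
  have [->|yb] := eqVneq y (v b); first by rewrite nxb.
  by have [->|xy] := eqVneq x y; rewrite ?irr1 ?orbF.
have sz2 : size (contr_mx M a b) = size M by rewrite size_contr_mx.
have [|||||||||e' [M' [Ke' se' e'C [szM' lowM'] need_le]]] := IH (contr_mx M a b) [seq x <- s | x != b] e2;
  rewrite ?sz2 //.
- exact: contr_sym.
- exact: contr_irr.
- exact: lower_contr.
- by move=> i; rewrite mem_filter => /andP[_ /s_lt].
- by move=> x xC i; rewrite mem_filter => /andP[_ si]; rewrite e2C ?Cs.
exists e', M'; split=> //; last by rewrite szM' sz2.
- by move/Ke'; apply: K_model_contr.
- by move=> x xC y; rewrite e'C ?e2C.
Qed.

(** The checks range over all subsets of [N(u)], so one of them treats the actual [S]. Success of
    [dense] gives the second alternative; otherwise contracting [C] to [c] gives the minor. *)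
Lemma check_attached_sound u M v c (C : {set T}) :
  let S := [set y in N u | [exists z in C, e z y]] in
  cone e u #|N u| M v -> every (check_attached r M) (bitseqs (size M).-1) ->
  linked e c C -> u \notin C -> [disjoint N u & C] ->
  (forall x y, x \in C -> e x y -> y \in C :|: N u) ->
  K_model r e \/ exists e', [/\ K_model r e' -> K_model r e, symmetric e' /\ irreflexive e',
    {in C, forall x y, e' x y = e x y} &
    2 * (r - 2) * #|S| + 2 - #|S| - r.-1 * (r - 2) <= \sum_(x in S) #|nbr e' x :&: S|].
Proof.
move=> S coneM; rewrite everyE => chk lC uC NC Cout; case: (coneM) => szM v_inj v0 vN exM.
have [cC _] := lC.
have vC i : i < #|N u|.+1 -> v i \notin C.
  case: i => [|i] li; rewrite ?v0 //; apply/negP; rewrite (disjointFr NC) //; exact: vN.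
pose b := [seq v i \in S | i <- iota 1 #|N u|].
have szb : size b = (size M).-1 by rewrite szM size_map size_iota.
have nth_b i : i <= #|N u| -> nth false (false :: b) i = (v i \in S).
  case: i => [|i] li /=; first by rewrite v0 !inE irr_e.
  by rewrite (nth_map 0) ?size_iota // nth_iota.
have {chk} := allP chk b; rewrite -szb mem_bitseqs => /(_ isT).
rewrite /check_attached; set Sl := [seq i <- _ | _]; set sl := [seq i <- _ | _].
have SlE i : (i \in Sl) = (i < size M) && (v i \in S).
  rewrite mem_filter mem_iota add0n szM leq0n; case: ltnP => li; last by rewrite !andbF.
  by rewrite nth_b // andbT; case: (_ \in S).
have us : uniq (map v Sl).
  apply: cone_map_uniq coneM _ _ => [|i]; first by rewrite filter_uniq ?iota_uniq.
  by rewrite SlE szM => /andP[].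
have mapSl : map v Sl =i S.
  move=> y; apply/mapP/idP => [[i]|yS]; first by rewrite SlE => /andP[_ ?] ->.
  have [|i li vi] := cone_surj coneM (y := y); first by move: yS; rewrite inE => /andP[].
  by exists i => //; rewrite SlE vi yS szM andbT; case/andP: li.
have szS : size Sl = #|S| by rewrite -(size_map v) -(card_uniqP us); apply: eq_card.
case: ifP => [|_ KM].
  move=> Hd; right; have [||||||||e' [M' [Ke' se' e'C [szM' lowM'] need_le]]] :=
    dense_sound (e1 := e) (v := v) (C := C) _ _ _ _ _ _ _ _ Hd; rewrite ?szM //.
  - exact: exact_lower.
  - by move=> i; rewrite mem_filter mem_iota szM => /andP[_].
  - by move=> i; rewrite SlE szM => /andP[].
  - by move=> x xC i li; apply: contraNneq (vC i li) => ->.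
  - move=> x xC i; rewrite mem_filter mem_iota add0n szM => /andP[nb li].
    rewrite nth_b // in nb; apply: contra nb => xi.
    have := Cout _ _ xC xi; rewrite !in_setU (negbTE (vC _ li)) /= => viN.
    by rewrite inE viN; apply/existsP; exists x; rewrite xC.
  exists e'; split=> //; rewrite szS in need_le; apply: leq_trans need_le _.
  rewrite sumnE big_map.
  have -> : \sum_(x in S) #|nbr e' x :&: S| = \sum_(x <- map v Sl) #|nbr e' x :&: S|.
    by rewrite (big_uniq _ us); apply: eq_bigl => x; rewrite mapSl.
  rewrite big_map !big_seq; apply: leq_sum => i iS.
  rewrite -size_filter -(size_map v); apply: uniq_size_leq_card => [|y /mapP[j]].
    apply: cone_map_uniq coneM _ _ => [|j]; first by rewrite !filter_uniq ?iota_uniq.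
    by rewrite mem_filter SlE szM => /andP[_ /andP[]].
  rewrite mem_filter => /andP[ij jS] ->; rewrite in_setI -(mapSl (v j)) map_f // andbT inE.
  by apply: lowM' => //; rewrite szM'; move: iS jS; rewrite !SlE => /andP[? _] /andP[? _].
left; have [e' [[se' irr'] Ke' e'I e'd]] := contract_linked r se irr_e lC.
apply/Ke'/(hasKM_sound (v := fun i => if i == size M then c else v i) se' irr' _ _ KM).
- by rewrite size_ext_mx szM; apply: inj_below_ext => // i /vC; apply: contraNneq => ->.
- apply: lower_ext => // [i j li lj|i li].
    by rewrite exM // => vij; apply: e'I => //; apply: vC; rewrite -szM.
  rewrite szM in li; rewrite nth_b // inE => /andP[_ /existsP[z /andP[zC zv]]].
  by apply: e'd zC zv; apply: vC.
Qed.

End Checks.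

(** * Extremal argument *)

Lemma check_true : every check [:: 3; 4; 5; 6; 7] = true.
Proof. by vm_cast_no_check (erefl true). Qed.

(** [D] is a degree sum over [C] and [S], of sizes [c] and [s]; the extra [s] is one neighbour in
    [C] per vertex of [S]. Fixing [r] makes the arithmetic linear. *)
Lemma edge_count r s c E D : 3 <= r <= 7 ->
  2 * (r - 2) * s + 2 - s - r.-1 * (r - 2) <= E -> c * (2 * r - 4) + (s + E) <= D ->
  2 * (r - 2) * (c + s) + 2 <= D + r.-1 * (r - 2).
Proof. by case: r => [|[|[|[|[|[|[|[|r]]]]]]]] //= _; lia. Qed.

(** On [r - 2] or [r - 1] vertices the bound asks for more edges than a complete graph has. *)
Lemma small_order r a d : 3 <= r <= 7 -> r - 2 <= a -> ~~ (r <= a) ->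
  2 * (r - 2) * a + 2 <= d + r.-1 * (r - 2) -> a * a.-1 < d.
Proof.
move=> r_range ge_a lt_a.
have [->|->] : a = r - 2 \/ a = r - 1 by move: ge_a lt_a r_range; clear; lia.
all: by case: r r_range {ge_a lt_a} => [|[|[|[|[|[|[|[|r]]]]]]]] //= _; lia.
Qed.

(** At most [r - 2] edges are lost, and the bound drops by [r - 2] per vertex. *)
Lemma contr_count r n d d' i : 3 <= r <= 7 -> r <= n -> i <= r - 3 -> d <= d' + 2 + 2 * i ->
  2 * (r - 2) * n + 2 <= d + r.-1 * (r - 2) -> 2 * (r - 2) * n.-1 + 2 <= d' + r.-1 * (r - 2).
Proof. by case: r => [|[|[|[|[|[|[|[|r]]]]]]]] //= _; lia. Qed.

(** The slack [(r - 1)(r - 2)] must cover the 2 lost by the deletion and the 2 in the bound; at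
    [r = 3] it is only 2. *)
Lemma del_count r n d d' : 3 <= r <= 7 -> r != 3 -> (2 * r - 4) * n <= d -> d <= d' + 2 ->
  2 * (r - 2) * n + 2 <= d' + r.-1 * (r - 2).
Proof. by case: r => [|[|[|[|[|[|[|[|r]]]]]]]] //= _; lia. Qed.

Section Extremal.
Variables (T : finType) (r : nat).
Hypothesis r_range : 3 <= r <= 7.
Implicit Types (e f : rel T) (A : {set T}).

Definition degsum f := \sum_x #|nbr f x|.
Definition nonisolated f := [set x | nbr f x != set0].

(** Mader's bound with edges counted twice. The vertex set is a separate [A] because contractions
    leave isolated vertices in [T]. *)
Definition mader n := forall A f, symmetric f -> irreflexive f -> nonisolated f \subset A ->
  #|A| < n -> r - 2 <= #|A| -> 2 * (r - 2) * #|A| + 2 <= degsum f + r.-1 * (r - 2) -> K_model r f.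

Lemma sum_degsum f (P : pred T) : \sum_(x | P x) #|nbr f x| <= degsum f.
Proof. by rewrite /degsum [X in _ <= X](bigID P) leq_addr. Qed.

(** * Small vertices all of whose edges lie in many triangles *)

Section Core.
Variables (e : rel T) (n : nat).
Hypotheses (se : symmetric e) (irr_e : irreflexive e).
Hypothesis IHn : mader n.
Hypothesis supp_n : #|nonisolated e| <= n.
Local Notation N := (nbr e).
Hypothesis tri : forall u y, e u y -> #|N u| <= 2 * r - 5 -> r - 2 <= #|N u :&: N y|.

Lemma small_cone u : N u != set0 -> #|N u| <= 2 * r - 5 ->
  K_model r e \/ exists M v, cone e u #|N u| M v /\ check_cone r M.
Proof.
move=> /set0Pn[y0 y0N] small.
have [||[M [v [Mc coneM]]]] := @cones_complete T e se irr_e r (#|N u| - r.-1) u _ #|N u| (leqnn _).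
- move=> y yN; have uy : e u y by move: yN; rewrite inE.
  (* This difference also contains [y] itself, which brings the number of missed vertices down to
     [#|N u| - r.-1]. *)
  have : N u :\: N y = y |: [set x in N u | (x != y) && ~~ e y x].
    apply/setP => x; rewrite !inE; have [->|] := eqVneq x y; first by rewrite uy irr_e.
    by rewrite andbC.
  move/(congr1 (fun B : {set T} => #|B|)); rewrite cardsU1 !inE eqxx andbF /= => cD.
  have := cardsID (N y) (N u); have := tri uy small.
  by move: cD r_range; clear; lia.
- by left.
right; exists M, v; split=> //.
have uy0 : e u y0 by move: y0N; rewrite inE.
have lb : r.-1 <= #|N u|.
  have := tri uy0 small; have : #|N u :&: N y0| <= #|N u :\ y0|.
    apply/subset_leq_card/subsetP => x; rewrite !inE => /andP[-> y0x]; rewrite andbT.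
    by apply: contraTneq y0x => ->; rewrite irr_e.
  by have := cardsD1 y0 (N u); rewrite y0N; move: r_range; clear; lia.
have := check_true; rewrite everyE => /allP/(_ r); rewrite !inE => chk.
have {chk} : check r by apply: chk; move: r_range; clear; lia.
rewrite /check everyE => /allP/(_ #|N u|); rewrite mem_iota everyE => chk.
have lt : r.-1 <= #|N u| < r.-1 + (r - 3) by move: lb small r_range; clear; lia.
exact: (allP (chk lt)) Mc.
Qed.

(** [y] has no more neighbours than [w], so it is small too; common neighbours along its edges lie
    in [N[w]], and leaving out [w] costs one. *)
Lemma nested_good w y : y \in N w -> N y \subset w |: N w -> #|N w| <= 2 * r - 5 -> good e r w y.
Proof.
move=> yN sub small.
have le_N : #|N y| <= #|N w|.
  have : N y \subset (w |: N w) :\ y.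
    rewrite subsetD1 sub inE irr_e //.
  move/subset_leq_card; have := cardsD1 y (w |: N w); rewrite cardsU1 !inE irr_e /=.
  by move: yN; rewrite inE => ->; rewrite orbT; clear; lia.
apply/forallP => z; apply/implyP => zN; apply/implyP => yz.
have := tri yz (leq_trans le_N small).
have : N y :&: N z \subset w |: (N w :&: N y :&: N z).
  apply/subsetP => x; rewrite !inE => /andP[yx ->]; rewrite yx !andbT.
  by have := subsetP sub x; rewrite !inE; apply.
move/subset_leq_card; rewrite cardsU1; case: (w \notin _); move: r_range; clear; lia.
Qed.

Lemma nonisolated_nbr x y : e x y -> x \in nonisolated e.
Proof. by move=> xy; rewrite inE; apply/set0Pn; exists y; rewrite inE. Qed.

(** Minimality of the component is replaced by induction on the bound [k]. *)
Lemma component_case k u c : #|component e (u |: N u) c| < k -> u \in nonisolated e -> #|N u| <= 2 * r - 5 ->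
  c \in nonisolated e -> c \notin u |: N u -> K_model r e.
Proof.
elim: k u c => // k IHk u c ltk suppu smallu suppc cK.
set K := u |: N u in cK ltk; set C := component e K c in ltk.
have C_out x : x \in C -> x \notin K by apply: component_out.
have C_step x y : x \in C -> e x y -> y \notin K -> y \in C by apply: component_step.
have lC : linked e c C := component_linked _ se c.
have uC : u \notin C by apply/negP => /C_out; rewrite setU11.
have suppC x : x \in C -> x \in nonisolated e.
  move=> xC; have [->//|xc] := eqVneq x c.
  have [||y [z [yX zC zX yz]]] := lC.2 (C :\ x).
  - by rewrite in_setD1 eq_sym xc; exact: component_self.
  - by rewrite properD1.
  move: zX; rewrite in_setD1 zC andbT negbK => /eqP zx.
  by apply: (@nonisolated_nbr x y); rewrite se -zx.
have [/existsP[w /andP[wC smallw]]|] := boolP [exists w in C, #|N w| <= 2 * r - 5].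
  have suppw := suppC _ wC.
  have Nw : N w != set0 by move: suppw; rewrite inE.
  have [//|[M [v [coneM]]]] := small_cone Nw smallw.
  rewrite /check_cone; case: ifP => // nested _.
  set Kw := w |: N w; set D := component e Kw u.
  have uKw : u \notin Kw.
    have := C_out _ wC; rewrite /K /Kw !inE !negb_or eq_sym se => /andP[-> ->]//.
  have D_step x y : x \in D -> e x y -> y \notin Kw -> y \in D by apply: component_step.
  have [/forallP att|] := boolP [forall y, (y \in N w) ==> good e r w y || [exists z in D, e z y]].
    apply: (check_nested_sound se irr_e coneM nested (component_linked _ se u : linked e u D)).
    - by apply/negP => /(component_out uKw); rewrite setU11.
    - by rewrite disjoint_sym disjoints_subset; apply/subsetP => x /(component_out uKw); rewrite !inE negb_or => /andP[].
    - move=> y yN; have := att y; rewrite yN => /orP[->|/existsP[z /andP[zD zy]]]; first by left.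
      by right; exists z.
  rewrite negb_forall => /existsP[y]; rewrite negb_imply negb_or => /and3P[yN bad natt].
  have natt' z : e z y -> z \notin D.
    by move=> zy; apply: contra natt => zD; apply/existsP; exists z; rewrite zD.
  have wy : e w y by move: yN; rewrite inE.
  have yC : y \in C.
    apply: (C_step _ _ wC wy); rewrite !inE negb_or; apply/andP; split.
      by apply: contraNneq (C_out _ wC) => yu; rewrite /K !inE -yu se wy orbT.
    by apply/negP => /natt'; rewrite component_self.
  (* Since [y] is not good, it has a neighbour [z] outside [N[w]], in a component other than [D]. *)
  have [sub|/subsetPn[z]] := boolP (N y \subset Kw).
    by rewrite nested_good in bad.
  rewrite inE => yz zKw; have zy : e z y by rewrite se.
  have zD := natt' _ zy.
  have zK : z \notin K.
    rewrite !inE negb_or; apply/andP; split; first by apply: contraNneq zD => ->; exact: component_self.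
    by apply: contra zD => uz; apply: (D_step u) => //; exact: component_self.
  have zC : z \in C := C_step _ _ yC yz zK.
  (* The component of [z] avoids [w]; if it stays in [C], it is strictly smaller and induction
     applies. *)
  have [subC|/subsetPn[t tD tC]] := boolP (component e Kw z \subset C).
    apply: (IHk w z) => //; last exact: nonisolated_nbr zy.
    rewrite -ltnS; apply: leq_trans ltk; rewrite ltnS; apply: proper_card.
    apply/properP; split=> //; exists w => //; apply/negP => /(component_out zKw); rewrite setU11 //.
  (* Otherwise it leaves [C] through [N[u]], so it contains [u] and equals [D], against the choice
     of [z]. *)
  have [||x [y' [xX y'D y'X xy']]] := (component_linked _ se z : linked e z (component e Kw z)).2 (component e Kw z :&: C).
  - by rewrite in_setI component_self.
  - by apply/properP; split; [exact: subsetIl | exists t; rewrite // in_setI (negbTE tC) andbF].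
  case/setIP: xX => xD xC; rewrite in_setI y'D /= in y'X.
  have y'K : y' \in K by apply: contraR y'X => ?; apply: (C_step x).
  have uD : u \in component e Kw z.
    move: y'K; rewrite !in_setU1 => /predU1P[<-//|]; rewrite inE => uy'.
    by apply: (component_step zKw y'D) uKw; rewrite se.
  by case/negP: zD; rewrite /D (component_eq se uD) component_self.
rewrite negb_exists => /forallP bigC.
have Nu : N u != set0 by move: suppu; rewrite inE.
have [//|[M [v [coneM]]]] := small_cone Nu smallu.
rewrite /check_cone; case: ifP => // _ chk.
have CN x y : x \in C -> e x y -> y \in C :|: N u.
  move=> xC xy; rewrite in_setU; have [yK|yK] := boolP (y \in K); last by rewrite (C_step x y).
  case/setU1P: yK => [yu|->]; last by rewrite orbT.
  by have := C_out _ xC; rewrite !inE se -yu xy orbT.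
have NC : [disjoint N u & C].
  by rewrite disjoint_sym disjoints_subset; apply/subsetP => x /C_out; rewrite !inE negb_or => /andP[].
have [|[e' [Ke' [se' irr_e'] e'C le_edges]]] := check_attached_sound se irr_e coneM chk lC uC NC CN; first by [].
move: le_edges; set S := [set y in N u | _] => le_edges.
have CS x y : x \in C -> e x y -> y \in C :|: S.
  move=> xC xy; have := CN x y xC xy; rewrite !in_setU; case: (y \in C) => //= yN.
  by rewrite inE yN; apply/existsP; exists x; rewrite xC.
have disjCS : [disjoint C & S].
  rewrite disjoint_sym; apply: disjointWl NC; apply/subsetP => x; rewrite inE => /andP[]//.
(* Restricting to [C] and [S] leaves out [u], so the order is below [n] and [IHn] applies. *)
pose f : rel T := fun x y => [&& x \in C :|: S, y \in C :|: S & e' x y].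
apply/Ke'/(K_model_mono (e := f)); first by move=> x y /and3P[].
have cC : c \in C := component_self e K c.
have big x : x \in C -> 2 * r - 4 <= #|N x|.
  by move=> xC; have := bigC x; rewrite xC /= -ltnNge; move: r_range; clear; lia.
apply: (IHn (A := C :|: S)).
- by move=> x y; rewrite /f se' andbCA.
- by move=> x; rewrite /f irr_e' !andbF.
- apply/subsetP => x; rewrite inE => /set0Pn[y]; rewrite inE => /andP[]//.
- apply: leq_trans supp_n; apply: proper_card; apply/properP; split; last first.
    by exists u; rewrite // in_setU (negbTE uC) !inE irr_e.
  apply/subsetP => x; rewrite in_setU => /orP[/suppC//|]; rewrite !inE => /andP[ux _].
  by apply/set0Pn; exists u; rewrite inE se.
- have : N c \subset C :|: S by apply/subsetP => y; rewrite inE; apply: CS.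
  by move/subset_leq_card; have := big c cC; move: r_range; clear; lia.
have degC x : x \in C -> 2 * r - 4 <= #|nbr f x|.
  move=> xC; apply: leq_trans (big x xC) _; apply/subset_leq_card/subsetP => y; rewrite !inE => xy.
  by rewrite /f in_setU xC (CS x) // e'C.
have degS x : x \in S -> 1 + #|nbr e' x :&: S| <= #|nbr f x|.
  move=> xS; have := xS; rewrite inE => /andP[_ /existsP[z /andP[zC zx]]].
  have zS : z \notin S by rewrite (disjointFr disjCS zC).
  have -> : 1 + #|nbr e' x :&: S| = #|z |: (nbr e' x :&: S)|.
    by rewrite cardsU1 in_setI (negbTE zS) andbF.
  apply/subset_leq_card/subsetP => y; rewrite in_setU1 in_setI => /predU1P[->|/andP[xy yS]].
    by rewrite inE /f !in_setU xS zC orbT se' e'C.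
  by rewrite inE /f !in_setU xS yS !orbT; move: xy; rewrite inE.
have : \sum_(x in C) (2 * r - 4) + \sum_(x in S) (1 + #|nbr e' x :&: S|) <= degsum f.
  apply: leq_trans (sum_degsum f (fun x => x \in [predU C & S])).
  by rewrite bigU //=; apply: leq_add; apply: leq_sum.
rewrite big_split /= !sum_nat_const muln1 cardsU disjoint_setI0 // cards0 subn0.
exact: edge_count.
Qed.

(** If [N[u]] contains all non-isolated vertices, every neighbour of [u] is good by [nested_good],
    while [check_nested] provides one that is not. *)
Lemma core : (exists2 u, u \in nonisolated e & #|N u| <= 2 * r - 5) -> K_model r e.
Proof.
case=> u suppu smallu.
have [sub|/subsetPn[c suppc cK]] := boolP (nonisolated e \subset u |: N u); last first.
  exact: (component_case (ltnSn _) suppu smallu suppc cK).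
have Nu : N u != set0 by move: suppu; rewrite inE.
have [//|[M [v [coneM]]]] := small_cone Nu smallu.
rewrite /check_cone; case: ifP => // nested _.
have [y yN] := check_nested_bad coneM nested.
rewrite nested_good //; apply/subsetP => z; rewrite inE => yz.
by apply: (subsetP sub); apply: (@nonisolated_nbr z y); rewrite se.
Qed.

End Core.

(** * Degree sums under contraction and deletion *)

Lemma degsum_contr e a b : symmetric e -> irreflexive e -> e a b ->
  degsum e <= degsum (contr e a b) + 2 + 2 * #|nbr e a :&: nbr e b|.
Proof.
move=> se irr_e ab; set I := nbr e a :&: nbr e b; set f := contr e a b.
have nab : a != b by apply: contraTneq ab => ->; rewrite irr_e.
have degsumE (g : rel T) : degsum g = #|nbr g a| + #|nbr g b| + \sum_(x | (x != a) && (x != b)) #|nbr g x|.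
  by rewrite /degsum (bigD1 a) // (bigD1 b) 1?eq_sym //= addnA.
(* Such a vertex exchanges [b] for [a], and loses a neighbour only if it had both. *)
have other x : x != a -> x != b -> #|nbr e x| <= #|nbr f x| + (x \in I).
  move=> xa xb; have : nbr e x :\ b \subset nbr f x.
    apply/subsetP => y; rewrite !inE => /andP[yb xy]; rewrite /f /contr xb yb xy /= andbT.
    by apply: contraTneq xy => ->; rewrite irr_e.
  move/subset_leq_card; have := cardsD1 b (nbr e x); rewrite inE.
  case xbE: (e x b) => /= ->; last by clear; lia.
  case xI: (x \in I) => /=; first by clear; lia.
  have ax : ~~ e a x by move: xI; rewrite /I !inE (se b x) xbE andbT => ->.
  have af : a \in nbr f x by rewrite inE /f /contr xb xa nab eqxx (se b x) xbE /= !orbT.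
  have sub : a |: (nbr e x :\ b) \subset nbr f x.
    rewrite subUset sub1set af; apply/subsetP => y; rewrite !inE => /andP[yb xy].
    rewrite /f /contr xb yb xy /= andbT.
    by apply: contraTneq xy => ->; rewrite irr_e.
  by move: (subset_leq_card sub); rewrite cardsU1 !inE nab se (negbTE ax) /=; clear; lia.
(* The union of the two neighbourhoods loses only the ends; the common neighbours were counted
   twice. *)
have merged : #|nbr e a| + #|nbr e b| <= #|nbr f a| + 2 + #|I|.
  rewrite -cardsUI leq_add2r.
  have : (nbr e a :|: nbr e b) :\ a :\ b \subset nbr f a.
    apply/subsetP => y; rewrite !inE => /and3P[yb ya H].
    by rewrite /f /contr nab yb eq_sym ya eqxx /=; case/orP: H => ->; rewrite ?orbT.
  move/subset_leq_card; have := cardsD1 b ((nbr e a :|: nbr e b) :\ a).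
  have := cardsD1 a (nbr e a :|: nbr e b).
  by case: (a \in _); case: (b \in _); clear; lia.
have sumI : \sum_(x | (x != a) && (x != b)) (x \in I : nat) <= #|I|.
  rewrite -sum1_card big_mkcond [X in _ <= X]big_mkcond /=.
  by apply: leq_sum => x _; case: (x \in I); case: ifP.
have sum_other : \sum_(x | (x != a) && (x != b)) #|nbr e x| <=
    \sum_(x | (x != a) && (x != b)) #|nbr f x| + #|I|.
  apply: leq_trans (leq_add (leqnn _) sumI).
  by rewrite -big_split; apply: leq_sum => x /andP[xa xb]; apply: other.
rewrite !degsumE; move: merged sum_other; clear; lia.
Qed.

Lemma degsum_del_edge e a b : irreflexive e ->
  e a b -> degsum (del_edge e a b) < degsum e <= degsum (del_edge e a b) + 2.
Proof.
move=> irr_e ab; set f := del_edge e a b.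
have nab : a != b by apply: contraTneq ab => ->; rewrite irr_e.
have le_f x : #|nbr f x| <= #|nbr e x|.
  by apply/subset_leq_card/subsetP => y; rewrite !inE => /andP[].
apply/andP; split.
  rewrite /degsum (bigD1 a) //= [X in _ < X](bigD1 a) //= -addSn.
  apply: leq_add; last by apply: leq_sum.
  apply: proper_card; apply/properP; split; first by apply/subsetP => y; rewrite !inE => /andP[].
  by exists b; rewrite inE // /f /del_edge ab !eqxx.
have le_e x : #|nbr e x| <= #|nbr f x| + ((x == a) + (x == b)).
  have [xa|xa] := eqVneq x a.
    rewrite xa (negbTE nab) addn0 (cardsD1 b) addnC leq_add ?leq_b1 //; apply/subset_leq_card/subsetP => y.
    by rewrite !inE /f /del_edge => /andP[yb ->]; rewrite (negbTE yb) (negbTE nab) andbF.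
  have [xb|xb] := eqVneq x b.
    rewrite (cardsD1 a) addnC leq_add ?leq_b1 //; apply/subset_leq_card/subsetP => y.
    by rewrite !inE /f /del_edge (negbTE xa) => /andP[ya ->]; rewrite (negbTE ya) andbF.
  rewrite addn0; apply/subset_leq_card/subsetP => y.
  by rewrite !inE /f /del_edge (negbTE xa) (negbTE xb) => ->.
have : degsum e <= \sum_x (#|nbr f x| + ((x == a) + (x == b))) by apply: leq_sum.
move/leq_trans; apply; rewrite !big_split /= leq_add2l.
by rewrite (bigD1 a) //= eqxx big1 => [|x /negbTE->//]; rewrite (bigD1 b) //= eqxx big1 // => x /negbTE->.
Qed.

(** * Mader's bound *)

Lemma degsum_upper A e : irreflexive e -> symmetric e -> nonisolated e \subset A ->
  degsum e <= #|A| * #|A|.-1.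
Proof.
move=> irr_e se sub; rewrite /degsum (bigID (mem A)) /= [X in _ + X]big1 ?addn0.
  rewrite -sum_nat_const; apply: leq_sum => x xA.
  have : nbr e x \subset A :\ x.
    apply/subsetP => y; rewrite !inE => xy; apply/andP; split.
      by apply: contraTneq xy => ->; rewrite irr_e.
    by apply: (subsetP sub); apply: (@nonisolated_nbr e y x); rewrite se.
  by move/subset_leq_card; have := cardsD1 x A; rewrite xA; clear; lia.
move=> x xA; apply/eqP; rewrite cards_eq0; apply: contraNT xA => Nx.
by apply: (subsetP sub); rewrite inE.
Qed.

Lemma degsum_lower A e d : {in A, forall x, d <= #|nbr e x|} -> d * #|A| <= degsum e.
Proof.
move=> ge_d; apply: leq_trans (sum_degsum e (mem A)).
by rewrite mulnC -sum_nat_const; apply: leq_sum.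
Qed.

(** Induction on the order and, for a fixed order, on the degree sum, so that edges can be
    deleted. *)
Lemma mader_all n : mader n.
Proof.
elim: n => [//|n IHn] A e; have [m] := ubnP (degsum e); elim: m e => // m IHm e lt_m se irr_e sub.
rewrite ltnS leq_eqVlt => /predU1P[cA|]; last by move=> *; apply: (IHn A e).
move=> geA thr; have rA : r <= #|A|.
  have := degsum_upper irr_e se sub; rewrite leqNgt; apply: contraR => lt_r.
  exact: small_order r_range geA lt_r thr.
have [/existsP[a /existsP[b /andP[ab few]]]|] :=
    boolP [exists a, exists b, e a b && (#|nbr e a :&: nbr e b| <= r - 3)].
  apply: (K_model_contr ab); have bA : b \in A.
    by apply: (subsetP sub); apply: (@nonisolated_nbr e b a); rewrite se.
  have cAb : #|A :\ b| = #|A|.-1 by rewrite (cardsD1 b A) bA.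
  apply: (IHn (A :\ b)); rewrite ?cAb.
  - exact: contr_sym.
  - exact: contr_irr.
  - apply/subsetP => x; rewrite !inE => /set0Pn[y]; rewrite inE => /and4P[-> _ _ H] /=.
    by apply: (subsetP sub); case/or3P: H => [/nonisolated_nbr//|/andP[/eqP-> _]|/andP[_]];
      [exact: nonisolated_nbr ab | rewrite se => /nonisolated_nbr].
  - by rewrite -cA; move: rA r_range; clear; lia.
  - by move: rA r_range; clear; lia.
  - exact: contr_count r_range rA few (degsum_contr se irr_e ab) thr.
rewrite negb_exists => /forallP many.
have tri a b : e a b -> r - 2 <= #|nbr e a :&: nbr e b|.
  move=> ab; have := many a; rewrite negb_exists => /forallP/(_ b); rewrite ab /= -ltnNge.
  by move: r_range; clear; lia.
have [/existsP[x /andP[xA Nx]]|] := boolP [exists x in A, nbr e x == set0].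
  have cAx : #|A :\ x| = #|A|.-1 by rewrite (cardsD1 x A) xA.
  apply: (IHn (A :\ x)) => //; rewrite ?cAx.
  - apply/subsetD1P; split=> //; by rewrite inE negbK.
  - by rewrite -cA; move: rA r_range; clear; lia.
  - by move: rA r_range; clear; lia.
  - by apply: leq_trans thr; rewrite leq_add2r leq_mul2l leq_pred orbT.
rewrite negb_exists => /forallP noniso.
have supp x : x \in A -> x \in nonisolated e.
  by move=> xA; have := noniso x; rewrite xA inE.
have [/existsP[x /andP[xA small]]|] := boolP [exists x in A, #|nbr e x| <= 2 * r - 5].
  apply: (core (n := n)) => //; [|by move=> u y uy _; apply: tri|by exists x => //; apply: supp].
  by rewrite -cA subset_leq_card.
rewrite negb_exists => /forallP small.
have big x : x \in A -> 2 * r - 4 <= #|nbr e x|.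
  by move=> xA; have := small x; rewrite xA /= -ltnNge; move: r_range; clear; lia.
have [a aA] : exists a, a \in A by apply/card_gt0P; move: rA r_range; clear; lia.
have := supp a aA; rewrite inE => /set0Pn[b]; rewrite inE => ab.
(* For [r = 3] a deletion has no slack, but [tri] provides a triangle at once. *)
have [r3|r3] := eqVneq r 3.
  have := tri a b ab; rewrite r3 => /card_gt0P[c]; rewrite !inE => /andP[ac bc].
  have [nab nac nbc] : [/\ a != b, a != c & b != c].
    by split; [apply: contraTneq ab|apply: contraTneq ac|apply: contraTneq bc] => ->; rewrite irr_e.
  apply: (@K_model_clique _ _ _ [set a; b; c]) => [|x y].
    by rewrite setUC cardsU1 cards2 nab !inE negb_or eq_sym nac eq_sym nbc.
  rewrite !inE -!orbA => /or3P[] /eqP-> /or3P[] /eqP->; rewrite ?eqxx // => _ //; by rewrite se.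
have /andP[lt_deg le_deg] := degsum_del_edge irr_e ab.
apply: (@K_model_mono _ _ (del_edge e a b)); first by move=> x y /andP[].
apply: IHm => //.
- by move: lt_m lt_deg; clear; lia.
- by move=> x y; rewrite /del_edge se; congr (_ && ~~ _); rewrite orbC (andbC (x == b)) (andbC (x == a)).
- by move=> x; rewrite /del_edge irr_e.
- apply: subset_trans sub; apply/subsetP => x; rewrite !inE => /set0Pn[y]; rewrite inE => /andP[xy _].
  by apply/set0Pn; exists y; rewrite inE.
- by rewrite cA.
- exact: del_count r_range r3 (degsum_lower big) le_deg.
Qed.


End Extremal.

Theorem mainTheorem1 (r : nat) (T : finType) (e : rel T) :
  symmetric e -> irreflexive e ->
  3 <= r <= 7 ->
  ~ has_K_minor e r ->
  (exists u v, e u v) ->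
  exists u v, [/\ e u v, deg e u <= 2 * r - 5 & ntri e u v <= r - 3].
Proof.
move=> se irr_e r_range noK [a [b ab]].
have [/existsP[u /existsP[v /and3P[*]]]|] :=
    boolP [exists u, exists v, [&& e u v, deg e u <= 2 * r - 5 & ntri e u v <= r - 3]].
  by exists u, v.
rewrite negb_exists => /forallP many; case: noK.
have tri u y : e u y -> #|nbr e u| <= 2 * r - 5 -> r - 2 <= #|nbr e u :&: nbr e y|.
  move=> uy small; have -> : #|nbr e u :&: nbr e y| = ntri e u y.
    by apply: eq_card => x; rewrite !inE.
  have := many u; rewrite negb_exists => /forallP/(_ y); rewrite uy /deg small /= -ltnNge.
  by move: r_range; clear; lia.
apply: K_model_has_K_minor => //; first by move: r_range; clear; lia.
(* Without a small non-isolated vertex, all degrees there are at least [2r - 4], and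
   [(r - 1)(r - 2) >= 2] puts the degree sum above Mader's bound. *)
have [/existsP[u /andP[suppu small]]|] := boolP [exists u in nonisolated e, #|nbr e u| <= 2 * r - 5].
  by apply: (core r_range se irr_e (@mader_all T r r_range #|nonisolated e|)) => //; exists u.
rewrite negb_exists => /forallP small.
have big x : x \in nonisolated e -> 2 * r - 4 <= #|nbr e x|.
  by move=> xA; have := small x; rewrite xA /= -ltnNge; move: r_range; clear; lia.
apply: (@mader_all T r r_range #|nonisolated e|.+1 (nonisolated e)) => //.
- have : nbr e a \subset nonisolated e.
    by apply/subsetP => y; rewrite inE => ay; apply: (@nonisolated_nbr T e y a); rewrite se.
  by move/subset_leq_card; have := big a (nonisolated_nbr ab); move: r_range; clear; lia.
- have := degsum_lower big.
  case: r r_range {many tri small big} => [|[|[|[|[|[|[|[|r]]]]]]]] //= _; lia.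
Qed.
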